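(* Let $n$ be a positive integer and let $K_{n,n}$ have color classes $U$ and $V$, where $U=U_1\uplus U_2\uplus U_3$ and $V=V_1\uplus V_2\uplus V_3$ are partitions with $|U_i|=|V_i|\ge\lfloor n/3\rfloor$ for $i=1,2,3$. Let $D$ be a bipartite demand graph on $U\cup V$ whose every edge joins a vertex of $U$ to a vertex of $V$. Suppose $\Delta(D)\le\lfloor n/3\rfloor$ and that for all $i\ne j$ no edge of $D$ joins a vertex of $U_i$ to a vertex of $V_j$. Then $D$ is resolvable in $K_{n,n}$.
   Context: A demand graph on the vertex set of a simple base graph $G$ is a loopless multigraph $D$ with $V(D)=V(G)$ (parallel edges allowed). $D$ is resolvable in $G$ if one can assign to each edge of $D$ (counted with multiplicity) a path in $G$ joining the two endpoints of that edge, such that the assigned paths are pairwise edge-disjoint. $\Delta(D)$ is the maximum degree of $D$, counting edges with multiplicity; $\uplus$ denotes disjoint union. *)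

(* Defs.v *)
From HB Require Import structures.
From mathcomp Require Import all_boot.
Set Implicit Arguments.
Unset Strict Implicit.
Unset Printing Implicit Defensive.

Record simple_graph := SimpleGraph {
  vertex : finType;
  adj : rel vertex;
  adj_sym : symmetric adj;
  adj_irrefl : irreflexive adj
}.

(* Multi-edges are elements of an arbitrary finite index type, so that parallel
   edges are distinct elements with the same ends. The order of the two
   components of [dends d] carries no meaning. *)
Record demand_graph (G : simple_graph) := DemandGraph {
  dedge : finType;
  dends : dedge -> vertex G * vertex G;
  dloopless : forall d, (dends d).1 != (dends d).2
}.

Section Demand.
Variables (G : simple_graph) (D : demand_graph G).

Definition joins (d : dedge D) (x y : vertex G) : bool :=
  (dends d == (x, y)) || (dends d == (y, x)).

Definition demand_degree (x : vertex G) : nat :=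
  #|[set d : dedge D | (x == (dends d).1) || (x == (dends d).2)]|.

Definition max_demand_degree : nat := \max_(x : vertex G) demand_degree x.

(* The path has vertex sequence [x :: p]. *)
Definition is_path (x y : vertex G) (p : seq (vertex G)) : bool :=
  [&& path (@adj G) x p, uniq (x :: p) & last x p == y].

Definition path_edges (x : vertex G) (p : seq (vertex G)) :
    seq {set vertex G} :=
  pairmap (fun u v => [set u; v]) x p.

Definition resolvable : Prop :=
  exists P : dedge D -> seq (vertex G),
    (forall d, is_path (dends d).1 (dends d).2 (P d)) /\
    (forall d d', d != d' ->
       [disjoint path_edges (dends d).1 (P d)
               & path_edges (dends d').1 (P d')]).

End Demand.

Definition is_inl (A B : Type) (x : A + B) : bool :=
  if x is inl _ then true else false.

Definition Kadj (m n : nat) : rel ('I_m + 'I_n) :=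
  fun x y => is_inl x != is_inl y.

Lemma Kadj_sym m n : symmetric (@Kadj m n).
Proof. by move=> x y; rewrite /Kadj eq_sym. Qed.

Lemma Kadj_irrefl m n : irreflexive (@Kadj m n).
Proof. by move=> x; rewrite /Kadj eqxx. Qed.

Definition complete_bipartite (m n : nat) : simple_graph :=
  SimpleGraph (@Kadj_sym m n) (@Kadj_irrefl m n).

Definition left_class (m n : nat) : {set vertex (complete_bipartite m n)} :=
  [set x : 'I_m + 'I_n | is_inl x].

Definition right_class (m n : nat) : {set vertex (complete_bipartite m n)} :=
  [set x : 'I_m + 'I_n | ~~ is_inl x].

(* Unlike [finset.partition], parts may be empty. *)
Definition is_disjoint_union (T I : finType) (A : I -> {set T}) (S : {set T}) :
    Prop :=
  \bigcup_i A i = S /\ forall i j, i != j -> [disjoint A i & A j].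

(* Main.v *)
Require Import Defs.
From HB Require Import structures.
From mathcomp Require Import all_boot.
From mathcomp Require Import zify.
Set Implicit Arguments.
Unset Strict Implicit.
Unset Printing Implicit Defensive.

(** Put k = n / 3 and |U_i| = |V_i| = k + r_i, so that r_0 + r_1 + r_2 <= 2. A
    demand (u, v) of part i is routed through the next part j along
    u, a, b, v with a in V_j and b in U_j; the blocks U_i x V_j, U_j x V_j and
    U_j x V_i then serve part i only. Such paths are edge-disjoint as soon as
    (u, a), (v, b) and (a, b) each determine the demand. A balanced colouring
    by V_j yields a, each value being taken at most k times, and Galvin's list
    colouring theorem, applied to the bipartite multigraph with an edge
    (v, a) for each demand, yields b; it even lets b avoid r_j prescribed
    neighbours of every a.

    Part i may have too many demands for this when r_i > r_j = 0. In that case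
    at most r_i edges at each vertex of V_i are taken from U_i x V_i, and part
    i - 1, when it is routed through part i, avoids them. They serve up to r_i
    demands at each v directly, except that for r_i = 2 a demand (u, v) may be
    parallel to one already served; it then takes a detour u, a, u', v with
    u' in U_i and a in V_j, where (u', a) is an edge left over by the
    colouring. *)

(** * König's edge colouring theorem *)

(** A bipartite multigraph is a set of edges with two end maps; its proper edge colourings are
    [proper_at] both. Any map, such as another colouring, can serve as an end. *)
Definition proper_at (E X C : eqType) (S : {pred E}) (x : E -> X) (c : E -> C) :=
  {in S &, forall e f, x e = x f -> c e = c f -> e = f}.

Lemma missing_color (E : finType) (c : E -> nat) (T : {set E}) (k : nat) :
  #|T| < k -> exists2 a, a < k & {in T, forall e, c e != a}.
Proof.
move=> ltTk.
have [/allP sub|/allPn[a]] := boolP (all (mem [seq c e | e in T]) (iota 0 k)).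
  have := uniq_leq_size (iota_uniq 0 k) sub.
  by rewrite size_iota size_map -cardE leqNgt ltTk.
rewrite mem_iota => lt_ak /= notin; exists a => // e eT.
by apply: contraNneq notin => <-; apply: image_f.
Qed.

Lemma proper_extend (E X : finType) (S : {set E}) (x : E -> X) (c : E -> nat)
    (e0 : E) (a : nat) :
  proper_at (S :\ e0) x c ->
  {in S :\ e0, forall e, x e = x e0 -> c e != a} ->
  proper_at S x (fun e => if e == e0 then a else c e).
Proof.
move=> pr fresh e f eS fS.
case: (eqVneq e e0) => [->|ne]; case: (eqVneq f e0) => [->|nf] // xef cef.
- have /fresh : f \in S :\ e0 by rewrite !inE nf.
  by rewrite -cef eqxx -xef => /(_ erefl).
- have /fresh : e \in S :\ e0 by rewrite !inE ne.
  by rewrite cef eqxx => /(_ xef).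
- by apply: pr; rewrite ?inE ?ne ?nf.
Qed.

Definition swap_color (a b c : nat) :=
  if c == a then b else if c == b then a else c.

Lemma swap_colorK a b : involutive (swap_color a b).
Proof.
move=> c; rewrite /swap_color.
case: (eqVneq c a) => [->|ca]; first by case: (eqVneq b a) => [->|_]; rewrite ?eqxx.
case: (eqVneq c b) => [->|cb]; first by rewrite eqxx.
by rewrite (negPf ca) (negPf cb).
Qed.

Lemma swap_color_lt a b c k : a < k -> b < k -> c < k -> swap_color a b c < k.
Proof. by rewrite /swap_color; case: ifP => // _; case: ifP. Qed.

Lemma swap_color_id a b c : c != a -> c != b -> swap_color a b c = c.
Proof. by rewrite /swap_color => /negPf-> /negPf->. Qed.

(* Swapping the colours [a] and [b] on the Kempe component of [y0] frees [a]
   there without touching [x0]; [Z] and [W] are the vertices of this component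
   in [Y] and in [X]. *)
Lemma kempe_swap (E X Y : finType) (x : E -> X) (y : E -> Y) (S : {set E})
    (c : E -> nat) (x0 : X) (y0 : Y) (a b k : nat) :
  proper_at S x c -> proper_at S y c -> a < k -> b < k ->
  {in S, forall e, c e < k} ->
  {in S, forall e, x e = x0 -> c e != a} ->
  {in S, forall e, y e = y0 -> c e != b} ->
  exists c' : E -> nat,
    [/\ proper_at S x c', proper_at S y c', {in S, forall e, c' e < k},
        {in S, forall e, x e = x0 -> c' e != a} &
        {in S, forall e, y e = y0 -> c' e != a}].
Proof.
move=> prx pry lta ltb ltc missa missb.
(* One step follows an edge of colour [a], then one of colour [b]. As [b] is missing at [y0], this
   reaches all of the component in [Y]. *)
pose step : rel Y := fun z z' => [exists e in S, exists f in S,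
  [&& c e == a, y e == z, x e == x f, c f == b & y f == z']].
pose Z := [set z | connect step y0 z].
pose W := [set x f | f in [set f in S | (c f == a) && (y f \in Z)]].
(* The swap can thus be read off at either end of an edge and stays proper at both. For colour [b],
   the last edge of the walk to [y e] is [e] itself. *)
have same e : e \in S -> (c e == a) || (c e == b) -> (y e \in Z) = (x e \in W).
  move=> eS /orP[/eqP ca|/eqP cb].
    apply/idP/imsetP => [yeZ|[f]]; first by exists e => //; rewrite inE eS ca eqxx.
    rewrite inE => /and3P[fS /eqP fa fZ] xef.
    by rewrite (prx e f) ?ca ?fa.
  apply/idP/imsetP => [|[f]]; last first.
    rewrite !inE => /and3P[fS /eqP fa fZ] xef.
    apply: connect_trans fZ (connect1 _).
    apply/exists_inP; exists f => //; apply/exists_inP; exists e => //.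
    by rewrite fa cb xef !eqxx.
  rewrite inE => /connectP[p]; case/lastP: p => [_ /= ye|p z].
    by have := missb e eS ye; rewrite cb eqxx.
  rewrite rcons_path last_rcons => /andP[pth] /exists_inP[f fS].
  case/exists_inP=> g gS /and5P[/eqP fa /eqP yf /eqP xfg /eqP gb /eqP yg] ye.
  have eg : e = g by apply: pry; rewrite // ?cb ?gb // ye yg.
  exists f; last by rewrite eg xfg.
  rewrite !inE fS fa eqxx yf /=; apply/connectP; by exists p.
pose c' e := if y e \in Z then swap_color a b (c e) else c e.
have c'x e : e \in S -> c' e = if x e \in W then swap_color a b (c e) else c e.
  move=> eS; rewrite /c'.
  have [ab|] := boolP ((c e == a) || (c e == b)); first by rewrite same.
  by rewrite negb_or => /andP[na nb]; rewrite swap_color_id // !if_same.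
exists c'; split.
- move=> e f eS fS xef; rewrite !c'x // xef.
  by case: ifP => _; [move/(can_inj (swap_colorK a b))|]; apply: prx.
- move=> e f eS fS yef; rewrite /c' yef.
  by case: ifP => _; [move/(can_inj (swap_colorK a b))|]; apply: pry.
- by move=> e eS; rewrite /c'; case: ifP => _; rewrite ?swap_color_lt ?ltc.
(* Every vertex of [W] has an edge of colour [a], so [x0] is not in [W]. *)
- move=> e eS xe; rewrite c'x //; case: ifP; last by rewrite missa.
  case/imsetP=> f; rewrite inE => /and3P[fS /eqP fa _] xef.
  by have := missa f fS; rewrite -xef xe fa eqxx => /(_ erefl).
- move=> e eS ye; rewrite /c' ye inE connect0.
  apply: contra (missb e eS ye) => /eqP/(congr1 (swap_color a b)).
  by rewrite swap_colorK => ->; rewrite /swap_color eqxx.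
Qed.

(** Induction on the edges: without [e0] each of its ends misses a colour, and a Kempe swap makes
    one colour missing at both. *)
Lemma konig_edge_coloring (E X Y : finType) (x : E -> X) (y : E -> Y)
    (S : {set E}) (k : nat) :
  (forall z, #|[set e in S | x e == z]| <= k) ->
  (forall z, #|[set e in S | y e == z]| <= k) ->
  exists c : E -> nat,
    [/\ {in S, forall e, c e < k}, proper_at S x c & proper_at S y c].
Proof.
have [m] := ubnP #|S|; elim: m => // m IHm in S *; rewrite ltnS => leSm dx dy.
have [->|[e0 e0S]] := set_0Vmem S.
  by exists (fun=> 0); split=> [e|e f|e f]; rewrite inE.
have dropx (T : finType) (z : E -> T) : (forall t, #|[set e in S | z e == t]| <= k) ->
    (forall t, #|[set e in S :\ e0 | z e == t]| <= k) /\
    #|[set e in S :\ e0 | z e == z e0]| < k.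
  move=> dz; split=> [t|].
    by apply: leq_trans (dz t); apply/subset_leq_card/subsetP=> e;
       rewrite !inE => /andP[/andP[_ ->] ->].
  apply: leq_trans (dz (z e0)); rewrite [X in _ < X](cardsD1 e0) !inE e0S eqxx.
  by rewrite ltnS; apply/subset_leq_card/subsetP=> e;
    rewrite !inE => /andP[/andP[-> ->] ->].
have [dx' /missing_color missx] := dropx _ _ dx.
have [dy' /missing_color missy] := dropx _ _ dy.
have [|c [ltc prx pry]] := IHm (S :\ e0) _ dx' dy'.
  by move: leSm; rewrite (cardsD1 e0) e0S.
have [a lta missa] := missx c; have [b ltb missb] := missy c.
have [] := @kempe_swap _ _ _ x y (S :\ e0) c (x e0) (y e0) a b k prx pry lta ltb ltc.
- by move=> e eS xe; apply: missa; rewrite inE eS xe eqxx.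
- by move=> e eS ye; apply: missb; rewrite inE eS ye eqxx.
move=> c' [prx' pry' ltc' missx' missy'].
exists (fun e => if e == e0 then a else c' e); split; try exact: proper_extend.
by move=> e eS; case: eqVneq => // ne; apply: ltc'; rewrite !inE ne.
Qed.

(** * Galvin's list colouring theorem *)

(* With [X] preferring large and [Y] small colours, this is the existence of a
   stable matching. *)
Lemma stable_matching (E X Y : finType) (x : E -> X) (y : E -> Y) (c : E -> nat)
    (T : {set E}) :
  proper_at T x c -> proper_at T y c ->
  exists K : {set E},
    [/\ K \subset T, {in K &, injective x}, {in K &, injective y} &
        forall f, f \in T :\: K -> exists2 g, g \in K &
          (x g = x f /\ c f < c g) \/ (y g = y f /\ c g < c f)].
Proof.
have [m] := ubnP #|T|; elim: m => // m IHm in T *; rewrite ltnS => leTm prx pry.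
(* First choices of the vertices of [X], as in deferred acceptance; if no two meet in [Y], they are
   the matching. *)
pose top := [set e in T | [forall f in T, (x f == x e) ==> (c f <= c e)]].
have topP e f : e \in top -> f \in T -> x f = x e -> c f <= c e.
  by rewrite inE => /andP[_ /forall_inP h] /h /implyP h' /eqP.
have topT : top \subset T by apply/subsetP=> e; rewrite inE => /andP[].
have topx : {in top &, injective x}.
  move=> e f et ft xef; apply: prx => //; try exact: (subsetP topT).
  by apply/eqP; rewrite eqn_leq !topP ?(subsetP topT).
have [/forall_inP inj|] :=
  boolP [forall e in top, forall f in top, (y e == y f) ==> (e == f)].
  exists top; split=> // [e f et ft yef|f].
    by have /forall_inP/(_ f ft) := inj e et; rewrite yef eqxx => /eqP.
  rewrite inE => /andP[ntop fT].
  have [|g /andP[gT /eqP xgf] maxg] := @arg_maxnP _ f (fun g => (g \in T) && (x g ==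
    x f)) c.
    by rewrite fT eqxx.
  have gtop : g \in top.
    rewrite inE gT; apply/forall_inP=> h hT; apply/implyP=> /eqP xhg.
    by apply: maxg; rewrite hT xhg xgf eqxx.
  have le_fg : c f <= c g by apply: maxg; rewrite fT eqxx.
  exists g => //; left; split=> //; rewrite ltn_neqAle le_fg andbT.
  by apply: contraNneq ntop => cfg; rewrite (prx f g).
rewrite negb_forall_in => /exists_inP[e1 e1t];
  rewrite negb_forall_in => /exists_inP[e2 e2t].
rewrite negb_imply => /andP[/eqP y12 ne12].
(* Two first choices meet in [Y]; the one with the larger colour, [e], is rejected and deleted. *)
have [e [e' [et e't ye ce]]] : exists e e', [/\ e \in top, e' \in top, y e' = y e &
  c e' < c e].
  have := ltngtP (c e1) (c e2); case=> [lt|lt|c12].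
  - by exists e2, e1.
  - by exists e1, e2.
  - by case/eqP: ne12; apply: pry => //; apply: (subsetP topT).
have eT := subsetP topT e et; have e'T := subsetP topT e' e't.
have sub : T :\ e \subset T by apply: subD1set.
have [||| K [KT xK yK dom]] := IHm (T :\ e).
- by move: leTm; rewrite (cardsD1 e) eT.
- by move=> f g fT gT; apply: prx; apply: (subsetP sub).
- by move=> f g fT gT; apply: pry; apply: (subsetP sub).
exists K; split=> // [|f]; first exact: subset_trans KT sub.
rewrite inE => /andP[nfK fT].
(* If [e'] is not in [K], the edge dominating it does so in [Y], because [e'] is a first choice, and
   hence also dominates [e]. *)
case: (eqVneq f e) => [->|nfe]; last by apply: dom; rewrite !inE nfK nfe.
case: (boolP (e' \in K)) => [e'K|ne'K]; first by exists e'; [|right].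
have [|g gK [[xg cg]|[yg cg]]] := dom e'.
- by rewrite !inE ne'K e'T andbT; apply: contraTneq ce => ->; rewrite ltnn.
- have gT : g \in T by apply: (subsetP (subset_trans KT sub)).
  by have := topP e' g e't gT xg; rewrite leqNgt cg.
- by exists g => //; right; rewrite yg ye (ltn_trans cg).
Qed.

(* Galvin's kernel method: in the invariant below, the two sets contain the
   edges that may take a colour of [L e] away from [e]. *)
Lemma kernel_list_coloring (E X Y C : finType) (x : E -> X) (y : E -> Y)
    (c0 : C) (c : E -> nat) (S : {set E}) (L : E -> {set C}) :
  proper_at S x c -> proper_at S y c ->
  {in S, forall e, #|[set f in S | (x f == x e) && (c e < c f)]| +
                   #|[set f in S | (y f == y e) && (c f < c e)]| < #|L e|} ->
  exists b : E -> C,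
    [/\ {in S, forall e, b e \in L e}, proper_at S x b & proper_at S y b].
Proof.
have [m] := ubnP #|S|; elim: m => // m IHm in S L *; rewrite ltnS => leSm prx pry big.
have [->|[e0 e0S]] := set_0Vmem S.
  by exists (fun=> c0); split=> [e|e f|e f]; rewrite inE.
have /card_gt0P[g gL] := leq_ltn_trans (leq0n _) (big e0 e0S).
(* The colour [g] goes to a stable matching [K] among the edges that admit it and is dropped from
   the other lists. *)
pose T := [set e in S | g \in L e].
have TS : T \subset S by apply/subsetP=> e; rewrite inE => /andP[].
have [e f eT fT|e f eT fT|K [KT xK yK dom]] := @stable_matching _ _ _ x y c T.
- by apply: prx; apply: (subsetP TS).
- by apply: pry; apply: (subsetP TS).
have KS := subset_trans KT TS.
have SKS : S :\: K \subset S by apply: subsetDl.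
have K0 : 0 < #|K|.
  have [e0K|e0K] := boolP (e0 \in K); first by apply/card_gt0P; exists e0.
  have [|h hK _] := dom e0; last by apply/card_gt0P; exists h.
  by rewrite !inE e0K e0S.
have [|e f eT fT|e f eT fT|e|b [bL prbx prby]] := IHm (S :\: K) (fun e => L e :\ g).
- by by apply: leq_trans leSm;
    rewrite -(cardsID K S) (setIidPr KS) -[X in X < _]add0n ltn_add2r.
- by apply: prx; apply: (subsetP SKS).
- by apply: pry; apply: (subsetP SKS).
- rewrite inE => /andP[neK eS]; have := big e eS; rewrite (cardsD1 g (L e)).
  set A := [set f in S | _]; set B := [set f in S | _].
  set A' := [set f in _ | _]; set B' := [set f in _ | _].
  have A'A : A' \subset A.
    by apply/subsetP=> f; rewrite !inE => /andP[/andP[_ ->] ->].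
  have B'B : B' \subset B.
    by apply/subsetP=> f; rewrite !inE => /andP[/andP[_ ->] ->].
  have leA := subset_leq_card A'A; have leB := subset_leq_card B'B.
  case gLe: (g \in L e); last exact: leq_ltn_trans (leq_add leA leB).
  (* An edge whose list loses [g] also loses a competitor [h] in [K], so the strict inequality
     survives. *)
  have [|h hK dh] := dom e; first by rewrite !inE neK eS gLe.
  have hS := subsetP KS h hK.
  rewrite add1n ltnS; apply: leq_trans.
  suff [lt|lt] : #|A'| < #|A| \/ #|B'| < #|B|.
  - by rewrite -addSn leq_add.
  - by rewrite -addnS leq_add.
  by case: dh => -[he che]; [left|right]; apply/proper_card/properP;
     split=> //; exists h; rewrite !inE ?hK ?hS ?he ?eqxx ?che.
exists (fun e => if e \in K then g else b e); split.
- move=> e eS; case: ifP => [eK|neK].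
    by have := subsetP KT e eK; rewrite inE => /andP[].
  by have := bL e; rewrite !inE neK eS => /(_ isT)/andP[].
- move=> e f eS fS xef.
  case: ifP => [eK|neK]; case: ifP => [fK|nfK].
  + by move=> _; apply: xK.
  + by move=> gb; have := bL f; rewrite !inE nfK fS -gb eqxx => /(_ isT).
  + by move=> bg; have := bL e; rewrite !inE neK eS bg eqxx => /(_ isT).
  + by apply: prbx; rewrite // inE ?neK ?nfK.
- move=> e f eS fS xef.
  case: ifP => [eK|neK]; case: ifP => [fK|nfK].
  + by move=> _; apply: yK.
  + by move=> gb; have := bL f; rewrite !inE nfK fS -gb eqxx => /(_ isT).
  + by move=> bg; have := bL e; rewrite !inE neK eS bg eqxx => /(_ isT).
  + by apply: prby; rewrite // inE ?neK ?nfK.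
Qed.

Lemma leq_card_nat (E : finType) (c : E -> nat) (A : {set E}) (m k : nat) :
  {in A &, injective c} -> {in A, forall e, m <= c e < m + k} -> #|A| <= k.
Proof.
move=> inj cA; rewrite -(size_iota m k) cardE -(size_map c); apply: uniq_leq_size.
  rewrite map_inj_in_uniq ?enum_uniq // => e f.
  by rewrite !mem_enum; apply: inj.
by move=> i /mapP[e]; rewrite mem_enum => eA ->; rewrite mem_iota cA.
Qed.

(** In a König colouring [c], at most [k - 1 - c e] edges at [x e] have a larger colour and at most
    [c e] at [y e] a smaller one: fewer than [k] in all. *)
Theorem galvin (E X Y C : finType) (x : E -> X) (y : E -> Y) (c0 : C)
    (S : {set E}) (L : E -> {set C}) (k : nat) :
  (forall z, #|[set e in S | x e == z]| <= k) ->
  (forall z, #|[set e in S | y e == z]| <= k) ->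
  {in S, forall e, k <= #|L e|} ->
  exists b : E -> C,
    [/\ {in S, forall e, b e \in L e}, proper_at S x b & proper_at S y b].
Proof.
move=> dx dy big; have [c [ltc prx pry]] := konig_edge_coloring dx dy.
apply: (kernel_list_coloring c0 prx pry) => e eS.
apply: leq_trans (big e eS).
set A := [set f in S | _]; set B := [set f in S | _].
have leA : #|A| <= k - (c e).+1.
  apply: (@leq_card_nat _ c _ (c e).+1) => [f f'|f]; rewrite !inE.
    by case/and3P=> fS /eqP xf _ /and3P[f'S /eqP xf' _]; apply: prx; rewrite ?xf.
  by case/and3P=> fS _ ->; rewrite subnKC ?ltc.
have leB : #|B| <= c e.
  apply: (@leq_card_nat _ c _ 0) => [f f'|f]; rewrite !inE.
    by case/and3P=> fS /eqP xf _ /and3P[f'S /eqP xf' _]; apply: pry; rewrite ?xf.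
  by case/and3P.
rewrite -[k](subnK (ltc e eS)) addnS ltnS; exact: leq_add leA leB.
Qed.

(** * Balanced colourings and the division of demands *)

(** Cut [A] into [p] blocks of at most [#|K|] edges and let [P] be one more block. Galvin's theorem
    for [x] against the block number [t], with all lists equal to [K], uses each colour at most once
    per block. *)
Lemma balanced_coloring (E X C : finType) (x : E -> X) (c0 : C) (K : {set C})
    (A P : {set E}) (p : nat) :
  (forall z, #|[set e in A :|: P | x e == z]| <= #|K|) ->
  [disjoint A & P] -> #|A| <= p * #|K| -> #|P| <= #|K| ->
  exists a : E -> C,
    [/\ {in A :|: P, forall e, a e \in K}, proper_at (A :|: P) x a,
        forall z, #|[set e in A | a e == z]| <= p & {in P &, injective a}].
Proof.
move=> dx dAP leA leP; set q := #|K| in dx leA leP.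
pose t e : 'I_p.+1 :=
  if e \in A then inord (index e (enum A) %/ q) else ord_max.
have idxA e : e \in A -> index e (enum A) < p * q.
  by move=> eA; apply: leq_trans leA; rewrite cardE index_mem mem_enum.
have tA e : e \in A -> t e = index e (enum A) %/ q :> nat /\ t e < p.
  move=> eA; have lt := idxA e eA; have q0 : 0 < q by case: (q) lt => //;
    rewrite muln0.
  have ltp : index e (enum A) %/ q < p by rewrite ltn_divLR.
  by rewrite /t eA inordK // ltnS ltnW.
have tP e : e \in P -> t e = ord_max.
  by move=> eP; rewrite /t; case: ifP => // /(disjointFr dAP); rewrite eP.
have dt z : #|[set e in A :|: P | t e == z]| <= q.
  have [ltz|lez] := ltnP z p; last first.
    apply: leq_trans leP; apply/subset_leq_card/subsetP => e.
    rewrite !inE => /andP[/orP[eA|//] /eqP tz].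
    by have [_] := tA e eA; rewrite tz ltnNge lez.
  have inA e : e \in [set e in A :|: P | t e == z] -> e \in A /\ index e (enum A) %/
    q = z.
    rewrite !inE => /andP[/orP[eA|eP] /eqP tz]; last by move: ltz;
      rewrite -tz tP // ltnn.
    by split=> //; have [<- _] := tA e eA; rewrite tz.
  apply: (@leq_card_nat _ (fun e => index e (enum A)) _ (z * q)) => [e f /inA[eA _]
    /inA[fA _]|e /inA[eA ez]].
    by move/(congr1 (nth e (enum A))); rewrite !nth_index ?mem_enum.
  have q0 : 0 < q by have := idxA e eA; case: (q) => //; rewrite muln0.
  by rewrite addnC -mulSn -(leq_divRL _ _ q0) -ltn_divLR // ez leqnn /=.
have [|a [aK pra prt]] := @galvin _ _ _ _ x t c0 (A :|: P) (fun=> K) q dx dt.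
  by [].
exists a; split=> // [z|e f eP fP aef].
  apply: (@leq_card_nat _ (fun e => nat_of_ord (t e)) _ 0) => [e f|e].
    rewrite !inE => /andP[eA /eqP ae] /andP[fA /eqP af] /val_inj tef.
    by apply: prt; rewrite ?inE ?eA ?fA // ae af.
  by rewrite inE => /andP[/tA[_ ->]].
by apply: prt; rewrite ?inE ?eP ?fP ?orbT // !tP.
Qed.

Lemma card_le_fibers (E Y : finType) (v : E -> Y) (S : {set E}) (V : {set Y})
    (p : nat) :
  {in S, forall d, v d \in V} ->
  (forall y, #|[set d in S | v d == y]| <= p) -> #|S| <= p * #|V|.
Proof.
move=> vV fib; rewrite -sum1_card (partition_big v (mem V)) //=.
rewrite mulnC -sum_nat_const; apply: leq_sum => y _; apply: leq_trans (fib y).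
by rewrite -sum1_card; apply: eq_leq; apply: eq_bigl => d; rewrite inE.
Qed.

Lemma subset_card_minn (E : finType) (S : {set E}) (k : nat) :
  exists2 P : {set E}, P \subset S & #|P| = minn k #|S|.
Proof.
exists [set d in take k (enum S)].
  by apply/subsetP=> d; rewrite inE => /mem_take; rewrite mem_enum.
by rewrite cardsE (card_uniqP (take_uniq _ (enum_uniq _))) size_take_min -cardE.
Qed.

(* The demands in [Dir] will be served by single edges, those in [P] by detours
   and those in [A] through parts of size [k + rj]. *)
Lemma split_excess (E X Y : finType) (u : E -> X) (v : E -> Y) (D : {set E})
    (Vi : {set Y}) (k ri rj : nat) :
  (forall z, #|[set d in D | u d == z]| <= k) ->
  (forall z, #|[set d in D | v d == z]| <= k) ->
  {in D, forall d, v d \in Vi} -> #|Vi| = k + ri -> ri + rj <= 2 ->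
  exists Dir P A : {set E},
    [/\ D = Dir :|: (A :|: P), [disjoint Dir & A :|: P] & [disjoint A & P]] /\
    [/\ #|A| <= k * (k + rj), #|P| <= k, P != set0 -> ri = 2,
        forall y, #|[set d in Dir :|: P | v d == y]| <= ri &
        {in Dir &, forall d f, u d = u f -> v d = v f -> d = f}] /\
    {in P, forall d, exists2 g, g \in Dir & u g = u d /\ v g = v d}.
Proof.
move=> du dv vVi cVi ler; have [c [ltc pru prv]] := konig_edge_coloring du dv.
have tail m : #|[set d in D | m <= c d]| <= (k - m) * (k + ri).
  rewrite -cVi; apply: (@card_le_fibers _ _ v) => [d|y].
    by rewrite inE => /andP[/vVi].
  apply: (@leq_card_nat _ c _ m) => [d f|d].
    rewrite !inE => /andP[/andP[dD _] /eqP vd] /andP[/andP[fD _] /eqP vf].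
    by apply: prv; rewrite ?vd.
  by rewrite !inE => /andP[/andP[dD ->] _]; have := ltc d dD; lia.
have [le_r|lt_r] := leqP ri rj.
  exists set0, set0, D; rewrite !setU0 set0U; split.
    by split=> //; rewrite -setI_eq0 ?set0I ?setI0.
  split; last by move=> d; rewrite inE.
  split; rewrite ?cards0 ?eqxx //.
  - have : #|D| <= (k - 0) * (k + ri).
      by apply: leq_trans (tail 0); apply/subset_leq_card/subsetP => d;
        rewrite inE => ->.
    by rewrite subn0 => /leq_trans; apply; rewrite leq_mul2l leq_add2l le_r orbT.
  - by move=> y; rewrite (_ : [set _ in _ | _] = set0) ?cards0 //; apply/setP=> d;
      rewrite !inE.
  - by move=> d; rewrite inE.
have rj0 : rj = 0 by lia.
have fiber1 (S : {set E}) y : {in S, forall d, d \in D /\ v d = y} ->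
    {in S &, forall d f, c d = c f} -> #|S| <= 1.
  move=> SD Sc; apply/card_le1_eqP => d f dS fS.
  have [dD vd] := SD d dS; have [fD vf] := SD f fS.
  by apply/esym; apply: prv; rewrite ?vd //; apply: Sc.
pose M i := [set d in D | c d == i].
have [ri1|ri2] : ri = 1 \/ ri = 2 by lia.
  (* One colour class is served directly; at most [(k - 1) * (k + 1) <= k * k] demands remain. *)
  exists (M 0), set0, [set d in D | 1 <= c d]; rewrite !setU0; split.
    split; last by rewrite -setI_eq0 setI0.
      by apply/setP=> d; rewrite !inE; case: (c d) => [|i];
        rewrite /= ?andbT ?andbF ?orbF.
    by rewrite -setI_eq0; apply/eqP/setP=> d; rewrite !inE; case: (c d) => [|i];
      rewrite /= ?andbT ?andbF.
  split; last by move=> d; rewrite inE.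
  split; rewrite ?cards0 ?eqxx //.
  - by apply: leq_trans (tail 1) _; rewrite ri1 rj0; nia.
  - rewrite ri1 => y; apply: (@fiber1 _ y) => [d|d f]; rewrite !inE.
      by case/andP=> /andP[-> _] /eqP.
    by case/andP=> /andP[_ /eqP->] _ /andP[/andP[_ /eqP->]].
  - move=> d f; rewrite !inE => /andP[dD /eqP cd] /andP[fD /eqP cf] _ vdf.
    by apply: prv; rewrite ?cd.
(* Demands of colour 1 whose direct edge is taken by a parallel demand of colour 0. Up to [k] of
   them form [P], the others join [A]. *)
pose par := [set d in M 1 | [exists g in M 0, (u g == u d) && (v g == v d)]].
have parM d : d \in par -> d \in D /\ c d = 1.
  by rewrite !inE => /andP[/andP[-> /eqP->]].
have parP d : d \in par -> exists2 g, g \in M 0 & u g = u d /\ v g = v d.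
  by rewrite inE => /andP[_ /exists_inP[g gM /andP[/eqP ug /eqP vg]]]; exists g.
have Npar d g : d \in D -> c d = 1 -> d \notin par -> g \in D -> c g = 0 ->
    u g = u d -> v g = v d -> False.
  move=> dD cd npar gD cg ug vg; case/negP: npar; rewrite inE inE dD cd eqxx /=.
  by apply/exists_inP; exists g; rewrite ?inE ?gD ?cg ?ug ?vg ?eqxx.
clearbody par; have [P Ppar cP] := subset_card_minn par k.
have PM d : d \in P -> d \in D /\ c d = 1 by move/(subsetP Ppar)/parM.
have le_par : #|par| <= 1 * (k + ri).
  rewrite -cVi; apply: (@card_le_fibers _ _ v) => [d /parM[/vVi]|y] //.
  apply: (@fiber1 _ y) => [d|d f].
    by rewrite inE => /andP[/parM[-> _] /eqP].
  by rewrite !inE => /andP[/parM[_ ->] _] /andP[/parM[_ ->] _].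
(* This makes [par] empty for [k <= 1], where truncated subtraction spoils the count. For larger
   [k], at most 2 elements of [par] join [A], and [(k - 2) * (k + 2) + 2 <= k * k]. *)
have le_par' : #|par| <= (k - 1) * (k + ri).
  by apply: leq_trans (tail 1); apply/subset_leq_card/subsetP=> d /parM[dD cd];
    rewrite inE dD cd.
exists (M 0 :|: (M 1 :\: par)), P, ([set d in D | 2 <= c d] :|: (par :\: P)); split.
  split.
  - apply/setP=> d; rewrite !inE.
    case dP: (d \in P); first by have [-> ->] := PM d dP; rewrite !orbT.
    case dpar: (d \in par); first by have [-> ->] := parM d dpar; rewrite !orbT.
    by case: (d \in D); case: (c d) => [|[|i]].
  - rewrite -setI_eq0; apply/eqP/setP=> d; rewrite !inE.
    case dP: (d \in P); first by have [-> ->] := PM d dP; rewrite (subsetP Ppar).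
    case dpar: (d \in par); first by have [-> ->] := parM d dpar.
    by case: (d \in D); case: (c d) => [|[|i]].
  - rewrite -setI_eq0; apply/eqP/setP=> d; rewrite !inE.
    by case dP: (d \in P); rewrite ?andbF //; have [-> ->] := PM d dP.
split; last first.
  by move=> d /(subsetP Ppar)/parP[g gM [ug vg]]; exists g; rewrite // inE gM.
split=> //.
- have leA : #|[set d in D | 2 <= c d] :|: (par :\: P)| <= (k - 2) * (k + ri) +
    (#|par| - #|P|).
    rewrite cardsU; apply: leq_trans (leq_subr _ _) (leq_add (tail 2) _).
    by rewrite cardsD (setIidPr Ppar).
  apply: leq_trans leA _; move: le_par le_par'; rewrite cP.
  move: #|par| => m; rewrite ri2 rj0 addn0 mul1n.
  case: (k) => [|[|j]]; [lia|lia|].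
  by rewrite !subSS !subn0 => le1 _; nia.
- by rewrite cP geq_minl.
- move=> y; rewrite ri2 -(cardsID (M 0)) -[2]/(1 + 1); apply: leq_add.
    apply: (@fiber1 _ y) => [d|d f]; rewrite !inE.
      by case/andP=> /andP[_ /eqP->] /andP[-> _].
    by case/andP=> _ /andP[_ /eqP->] /andP[_ /andP[_ /eqP->]].
  have c1 d : d \in [set d in M 0 :|: M 1 :\: par :|: P | v d == y] :\: M 0 ->
      [/\ d \in D, c d = 1 & v d = y].
    rewrite !inE => /and3P[+ + /eqP->].
    case dP: (d \in P); first by have [-> ->] := PM d dP.
    by case: (d \in D) => //=; case: (c d) => [|[|i]] //=; rewrite ?andbF.
  apply: (@fiber1 _ y) => [d /c1[]|d f /c1[_ -> _] /c1[_ ->]] //.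
- move=> d f; rewrite !inE => dM fM udf vdf.
  have := Npar d f; have := Npar f d; rewrite udf vdf.
  case/orP: dM => [/andP[dD /eqP cd]|/and3P[npd dD /eqP cd]];
  case/orP: fM => [/andP[fD /eqP cf]|/and3P[npf fD /eqP cf]] N1 N2.
  + by apply: prv; rewrite ?cd.
  + by case: N1.
  + by case: N2.
  + by apply: prv; rewrite ?cd.
Qed.

(** * Routing one part through the next *)

(* A demand from [x] to [y] is served by the edge [(x, y)] or, for
   [r = Some (a, b)], by the path [x, a, b, y]. *)
Definition route_edges (X Y : eqType) (r : option (Y * X)) (x : X) (y : Y) :
    seq (X * Y) :=
  if r is Some (a, b) then [:: (x, a); (b, a); (b, y)] else [:: (x, y)].

Definition column_degree (X Y : finType) (H : {set X * Y}) (y : Y) : nat :=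
  #|[set x | (x, y) \in H]|.

(* [Hi] is chosen before [Hj], so that around the cycle of the three parts
   the set avoided by each part can be the one used by the next. *)
Lemma route_part (E X Y : finType) (u : E -> X) (v : E -> Y) (D : {set E})
    (Ui Uj : {set X}) (Vi Vj : {set Y}) (k ri rj : nat) (x0 : X) (y0 : Y) :
  (forall z, #|[set d in D | u d == z]| <= k) ->
  (forall z, #|[set d in D | v d == z]| <= k) ->
  {in D, forall d, u d \in Ui /\ v d \in Vi} ->
  [disjoint Ui & Uj] -> [disjoint Vi & Vj] ->
  #|Ui| = k + ri -> #|Vi| = k + ri -> #|Uj| = k + rj -> #|Vj| = k + rj ->
  ri + rj <= 2 ->
  exists2 Hi : {set X * Y}, forall y, column_degree Hi y <= ri &
  forall Hj : {set X * Y}, (forall y, column_degree Hj y <= rj) ->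
  exists R : E -> option (Y * X),
    [/\ {in D, forall d, if R d is Some (a, b) then a != v d /\ b != u d else True},
        {in D, forall d e, e \in route_edges (R d) (u d) (v d) ->
          [\/ e.1 \in Ui /\ e.2 \in Vj, e.1 \in Uj /\ e.2 \in Vi,
              [/\ e.1 \in Ui, e.2 \in Vi & e \in Hi] |
              [/\ e.1 \in Uj, e.2 \in Vj & e \notin Hj]]} &
        {in D &, forall d f e, e \in route_edges (R d) (u d) (v d) ->
          e \in route_edges (R f) (u f) (v f) -> d = f}].
Proof.
move=> du dv DUV dUij dVij cUi cVi cUj cVj ler.
have Dv : {in D, forall d, v d \in Vi} by move=> d /DUV[].
have [Dir [P [A [[defD dDirN dAP] [[leA leP P2 dirdeg dirinj] Ppar]]]]] :=
  split_excess du dv Dv cVi ler.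
pose N := A :|: P.
have sND : N \subset D by rewrite defD subsetUr.
have sAN : A \subset N := subsetUl _ _.
have sPN : P \subset N := subsetUr _ _.
have sDirD : Dir \subset D by rewrite defD subsetUl.
have degS (T : finType) (z : E -> T) (S : {set E}) t p : S \subset D ->
    #|[set d in D | z d == t]| <= p -> #|[set d in S | z d == t]| <= p.
  move=> SD; apply: leq_trans; apply/subset_leq_card/subsetP=> d.
  by rewrite !inE => /andP[/(subsetP SD)-> ->].
have [|||| a [aVj ainj aA aP]] := @balanced_coloring _ _ _ u y0 Vj A P k.
- by move=> z; rewrite cVj; apply: leq_trans (leq_addr _ _); apply: degS.
- by [].
- by rewrite cVj.
- by rewrite cVj; apply: leq_trans (leq_addr _ _).
(* The detour of [d] in [P] needs a vertex [w] whose edge to [a d] starts no route. The colour [a d]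
   occurs at most [k] times on [A] and once on [P], while [Ui] has [k + 2] vertices. *)
pose free d w := (w \in Ui) && [forall e in N, (u e, a e) != (w, a d)].
pose w d := odflt (u d) [pick w | free d w].
have wP d : d \in P -> w d \in Ui /\ {in N, forall e, a e = a d -> u e != w d}.
  move=> dP; have ri2 : ri = 2 by apply: P2; apply/set0Pn; exists d.
  rewrite /w; case: pickP => [z /andP[zU /forall_inP zf]|none] /=.
    by split=> // e eN aed; apply: contraNneq (zf e eN) => <-; rewrite aed eqxx.
  have : Ui \subset u @: [set e in A | a e == a d] :|: [set u d].
    apply/subsetP=> z zU; have /negbT := none z; rewrite /free zU.
    rewrite negb_forall_in => /exists_inP[e eN]; rewrite negbK => /eqP[<- aed].
    move: eN; rewrite !inE => /orP[eA|eP]; last by rewrite (aP e d) ?eqxx ?orbT.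
    by rewrite imset_f // inE eA aed eqxx.
  move/subset_leq_card; rewrite cUi ri2 leqNgt => /negP[].
  apply: leq_ltn_trans (leq_of_leqif (leq_card_setU _ _)) _.
  rewrite cards1 addn1 addn2 !ltnS; apply: leq_trans (leq_imset_card _ _) (aA _).
pose Hi := [set (u d, v d) | d in Dir] :|: [set (w d, v d) | d in P].
exists Hi => [y|Hj degHj].
  apply: leq_trans (dirdeg y).
  pose g d := if d \in P then w d else u d.
  apply: leq_trans (leq_imset_card g _); apply/subset_leq_card/subsetP=> x.
  rewrite !inE => /orP[/imsetP[d dDir [-> ->]]|/imsetP[d dP [-> ->]]].
    apply/imsetP; exists d; first by rewrite !inE dDir eqxx.
    have := disjointFr dDirN dDir; rewrite !inE => /negbT; rewrite negb_or /g.
    by case/andP=> _ /negPf->.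
  by apply/imsetP; exists d; rewrite /g ?dP // !inE dP eqxx orbT.
(* Each list keeps at least [k] of the [k + rj] vertices of [Uj]. Demands in [P] are left out, as
   the fibres of [a] are bounded by [k] on [A] only. *)
have [|||b [bL binjv binja]] := @galvin _ _ _ _ v a x0 A
    (fun d => Uj :\: [set z | (z, a d) \in Hj]) k.
- by move=> z; apply: degS => //; apply: subset_trans sND.
- exact: aA.
- move=> d _; rewrite cardsD cUj; have := degHj (a d); rewrite /column_degree => le.
  have := subset_leq_card (subsetIr Uj [set z | (z, a d) \in Hj]).
  move: le; move: #|_ :&: _| #|[set _ | _]| => m1 m2; lia.
pose B d := if d \in P then w d else b d.
have NP d : d \in N -> d \in P \/ d \in A /\ d \notin P.
  rewrite !inE; case dP: (d \in P); first by left.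
  by rewrite orbF; right.
have BP d : d \in P -> B d = w d by rewrite /B => ->.
have BA d : d \notin P -> B d = b d by rewrite /B => /negPf->.
have bUj d : d \in A -> b d \in Uj /\ (b d, a d) \notin Hj.
  by move/bL; rewrite !inE => /andP[].
have BN d : d \in N -> (d \in P /\ B d \in Ui) \/
    [/\ d \in A, d \notin P, B d \in Uj & (B d, a d) \notin Hj].
  move=> dN; case: (NP d dN) => [dP|[dA dP]].
    by left; rewrite BP //; have [] := wP d dP.
  by right; rewrite BA //; have [] := bUj d dA.
have Uij z : z \in Ui -> z \in Uj -> False by move/(disjointFr dUij)->.
have Vij z : z \in Vi -> z \in Vj -> False by move/(disjointFr dVij)->.
have uN d : d \in N -> u d \in Ui by move/(subsetP sND)/DUV=> [].
have vN d : d \in N -> v d \in Vi by move/(subsetP sND)/DUV=> [].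
have uDir d : d \in Dir -> u d \in Ui by move/(subsetP sDirD)/DUV=> [].
have vDir d : d \in Dir -> v d \in Vi by move/(subsetP sDirD)/DUV=> [].
have DirN d : d \in Dir -> d \in N -> False by move/(disjointFr dDirN)->.
(* Since [ri = 2], a detour demand [d] and its parallel [g] exhaust [Dir :|: P] at their common
   end. *)
have three g d f : g \in Dir -> d \in P -> f \in Dir :|: P -> v g = v d -> v f = v d
  ->
    f = g \/ f = d.
  move=> gDir dP fDP vgd vfd.
  have ri2 : ri = 2 by apply: P2; apply/set0Pn; exists d.
  have [->|nfg] := eqVneq f g; first by left.
  have [->|nfd] := eqVneq f d; first by right.
  have ngd : g != d.
    by apply: contraTneq gDir => ->; apply/negP=> /DirN; apply; apply: (subsetP sPN).
  have : [set f; g; d] \subset [set e in Dir :|: P | v e == v d].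
    apply/subsetP=> e; rewrite !inE -orbA => /or3P[]/eqP->;
      rewrite ?vgd ?vfd ?eqxx ?gDir ?dP ?orbT //.
    by move: fDP; rewrite inE andbT.
  move/subset_leq_card/leq_trans/(_ (dirdeg _)); rewrite ri2.
  by rewrite -setUA cardsU1 cards2 !inE negb_or nfg nfd ngd.
(* Coincidences of two route edges: middle with middle ([F2]), last with last ([F3]), first with
   middle ([F5]), last with direct ([F6]); in [F7] the ends lie in [Vi] and [Vj]. *)
have F2 d f : d \in N -> f \in N -> B d = B f -> a d = a f -> d = f.
  move=> dN fN eB ea.
  case: (BN d dN) (BN f fN) => [[dP Bd]|[dA dP Bd _]] [[fP Bf]|[fA fP Bf _]].
  - exact: aP.
  - by case: (@Uij (B d)); rewrite // eB.
  - by case: (@Uij (B d)); rewrite // eB.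
  - by apply: binja => //; rewrite -!BA.
have F3 d f : d \in N -> f \in N -> B d = B f -> v d = v f -> d = f.
  move=> dN fN eB ev.
  case: (BN d dN) (BN f fN) => [[dP Bd]|[dA dP Bd _]] [[fP Bf]|[fA fP Bf _]].
  - have [g gDir [_ vg]] := Ppar d dP.
    case: (@three g d f) => //; first by rewrite inE fP orbT.
    by move=> fg; case: (@DirN f); rewrite // fg.
  - by case: (@Uij (B d)); rewrite // eB.
  - by case: (@Uij (B d)); rewrite // eB.
  - by apply: binjv => //; rewrite -!BA.
have F5 d f : d \in N -> f \in N -> u d = B f -> a d = a f -> False.
  move=> dN fN eu ea; case: (BN f fN) => [[fP Bf]|[fA fP Bf _]].
    by have [_ /(_ d dN ea)] := wP f fP; rewrite -BP // eu eqxx.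
  by case: (@Uij (u d)); rewrite ?eu // -eu uN.
have F6 d f : d \in N -> f \in Dir -> B d = u f -> v d = v f -> False.
  move=> dN fDir eB ev; case: (BN d dN) => [[dP Bd]|[dA dP Bd _]].
    (* Here [f] would be the parallel [g], hence [w d = u d]; but [w d] is free, and the route of
       [d] itself starts with the edge from [u d] to [a d]. *)
    have [g gDir [ug vg]] := Ppar d dP.
    case: (@three g d f) => //; first by rewrite inE fDir.
      by move=> fg; apply: (@F5 d d); rewrite // eB fg.
    by move=> fd; case: (@DirN f); rewrite // fd.
  by case: (@Uij (B d)); rewrite // eB uDir.
have DN d : d \in D -> (d \in Dir) = false -> d \in N.
  by rewrite {1}defD inE => /orP[->|].
pose R d := if d \in Dir then None else Some (a d, B d).
have RE d e : d \in D -> e \in route_edges (R d) (u d) (v d) ->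
    [\/ d \in Dir /\ e = (u d, v d), d \in N /\ e = (u d, a d),
        d \in N /\ e = (B d, a d) | d \in N /\ e = (B d, v d)].
  move=> dD; rewrite /R; case: ifP => [dDir|/DN-/(_ dD) dN] /=.
    by rewrite mem_seq1 => /eqP->; constructor 1.
  rewrite !in_cons in_nil orbF.
  by case/or3P=> /eqP->; [constructor 2|constructor 3|constructor 4].
have F7 d f : d \in D -> f \in N -> v d = a f -> False.
  by move=> dD fN ev; apply: (@Vij (v d)); [apply: Dv|rewrite ev aVj].
have DirD d : d \in Dir -> d \in D := subsetP sDirD d.
have ND d : d \in N -> d \in D := subsetP sND d.
exists R; split.
- move=> d dD; rewrite /R; case: ifP => // /DN-/(_ dD) dN; split.
    by apply/eqP=> /esym; apply: F7.
  by apply/eqP=> /esym /F5; apply.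
- move=> d dD e /(RE d e dD)[] [dN ->] /=.
  + constructor 3; split; rewrite ?uDir ?vDir //.
    by rewrite inE imset_f.
  + by constructor 1; rewrite uN ?aVj.
  + case: (BN d dN) => [[dP Bd]|[dA dP Bd nH]]; last by constructor 4; rewrite aVj.
    by constructor 1; rewrite aVj.
  + case: (BN d dN) => [[dP Bd]|[dA dP Bd nH]]; last by constructor 2; rewrite vN.
    constructor 3; split; rewrite ?vN // BP // inE; apply/orP; right.
    by apply/imsetP; exists d.
- move=> d f dD fD e /(RE d e dD) + /(RE f e fD).
  case=> -[dN ->] [] [fN] [].
  + exact: dirinj.
  + by move=> _ /F7; case.
  + by move=> _ /F7; case.
  + by move=> /esym e1 /esym e2; case: (F6 _ _ fN dN e1 e2).
  + by move=> _ /esym/F7; case; rewrite ?DirD.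
  + exact: ainj.
  + by move=> e1 e2; case: (F5 _ _ dN fN e1 e2).
  + by move=> _ /esym/F7; case; rewrite ?ND.
  + by move=> _ /esym/F7; case; rewrite ?DirD.
  + by move=> /esym e1 /esym e2; case: (F5 _ _ fN dN e1 e2).
  + exact: F2.
  + by move=> _ /esym/F7; case; rewrite ?ND.
  + by move=> e1 e2; case: (F6 _ _ dN fN e1 e2).
  + by move=> _ /F7; case.
  + by move=> _ /F7; case.
  + exact: F3.
Qed.

(** * From routes to paths in the complete bipartite graph *)

Lemma inl_inr_set2_inj (X Y : finType) (x x' : X) (y y' : Y) :
  [set inl x; inr y] = [set inl x'; inr y'] :> {set X + Y} -> (x, y) = (x', y').
Proof.
move=> eqS.
have : inl x \in [set inl x; inr y] by rewrite set21.
have : inr y \in [set inl x; inr y] by rewrite set22.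
by rewrite eqS !inE => /eqP[->] /orP[/eqP[->]|/eqP].
Qed.

Lemma resolvable_of_routes (n : nat) (D : demand_graph (complete_bipartite n n))
    (u v : dedge D -> 'I_n) (R : dedge D -> option ('I_n * 'I_n)) :
  (forall d, joins d (inl (u d)) (inr (v d))) ->
  (forall d, if R d is Some (a, b) then a != v d /\ b != u d else True) ->
  (forall d f e, e \in route_edges (R d) (u d) (v d) ->
     e \in route_edges (R f) (u f) (v f) -> d = f) ->
  resolvable D.
Proof.
move=> uv simple disj.
pose mid d : seq ('I_n + 'I_n) :=
  if R d is Some (a, b) then [:: inr a; inl b] else [::].
(* If [dends d] lists the right end first, the route is traversed backwards. *)
pose P d : seq ('I_n + 'I_n) :=
  if dends d == (inl (u d), inr (v d)) then rcons (mid d) (inr (v d))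
  else rcons (rev (mid d)) (inl (u d)).
have dendsP d : dends d = (inl (u d), inr (v d)) /\ P d = rcons (mid d) (inr (v d))
    \/ dends d = (inr (v d), inl (u d)) /\ P d = rcons (rev (mid d)) (inl (u d)).
  rewrite /P; case: eqP (uv d) => [->|ne]; first by left.
  by case/orP=> /eqP // ->; right.
exists P; split=> [d|d f ndf].
  have := simple d; case: (dendsP d) => -[-> ->] /=; rewrite /is_path /mid.
    case: (R d) => [[a b]|] /=; last by rewrite /Kadj eqxx.
    by case=> av bu; rewrite /Kadj /= !inE !eqxx /= !andbT eq_sym negb_or /= bu av.
  case: (R d) => [[a b]|] /=; last by rewrite /Kadj eqxx.
  by case=> av bu; rewrite /Kadj /= !inE !eqxx /= !andbT negb_or /= eq_sym av bu.
have edgesP g e : e \in path_edges (dends g).1 (P g) ->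
    exists2 z, z \in route_edges (R g) (u g) (v g) & e = [set inl z.1; inr z.2].
  case: (dendsP g) => -[-> ->]; rewrite /mid /route_edges.
    case: (R g) => [[a b]|] /=; rewrite !inE.
      case/or3P=> /eqP->; [exists (u g, a)|exists (b, a)|exists (b, v g)] => //=;
      by rewrite ?inE ?eqxx ?orbT // setUC.
    by move/eqP=> ->; exists (u g, v g); rewrite ?inE.
  case: (R g) => [[a b]|] /=; rewrite !inE.
    case/or3P=> /eqP->; [exists (b, v g)|exists (b, a)|exists (u g, a)] => //=;
    by rewrite ?inE ?eqxx ?orbT // setUC.
  by move/eqP=> ->; exists (u g, v g); rewrite ?inE //= setUC.
rewrite disjoint_subset; apply/subsetP => e /edgesP[z zd ez].
rewrite inE; apply/negP => /edgesP[z' zf ez'].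
have := inl_inr_set2_inj (etrans (esym ez) ez'); rewrite -!surjective_pairing => zz'.
by case/eqP: ndf; apply: disj zd _; rewrite zz'.
Qed.

(** * Assembling the three parts *)

Lemma disjoint_union_index (T I : finType) (A : I -> {set T}) (S : {set T})
    (i0 : I) :
  is_disjoint_union A S ->
  exists p : T -> I, {in S, forall x i, (x \in A i) = (p x == i)}.
Proof.
case=> covA disA; exists (fun x => odflt i0 [pick i | x \in A i]) => x.
rewrite -covA => /bigcupP[j _ xj] i; case: pickP => [l xl|/(_ j)]; last by rewrite xj.
apply/idP/eqP => [xi|<- //] /=; apply/eqP; apply/negP=> /negP/disA.
by move/disjointFr/(_ xl); rewrite xi.
Qed.

Lemma card_index_preim (X T I : finType) (g : X -> T) (A : I -> {set T})
    (S : {set T}) (p : T -> I) (i : I) :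
  injective g -> (forall t, (t \in S) = (t \in codom g)) ->
  is_disjoint_union A S ->
  {in S, forall t i, (t \in A i) = (p t == i)} ->
  #|[set x | p (g x) == i]| = #|A i|.
Proof.
move=> injg Sg [covA _] pA; rewrite -(card_imset _ injg); apply: eq_card => t.
apply/imsetP/idP => [[x]|tA].
  by rewrite inE => px ->; rewrite pA // Sg codom_f.
have tS : t \in S by rewrite -covA; apply/bigcupP; exists i.
have /codomP[x tx] : t \in codom g by rewrite -Sg.
by exists x; rewrite // inE -tx -pA.
Qed.

Theorem theorem2 (n : nat) (hn : 0 < n)
  (U V : 'I_3 -> {set vertex (complete_bipartite n n)})
  (hU : is_disjoint_union U (left_class n n))
  (hV : is_disjoint_union V (right_class n n))
  (hUV : forall i : 'I_3, #|U i| = #|V i|)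
  (hsize : forall i : 'I_3, n %/ 3 <= #|U i|)
  (D : demand_graph (complete_bipartite n n))
  (hbip : forall d : dedge D, exists u v,
      [/\ u \in left_class n n, v \in right_class n n & joins d u v])
  (hDelta : max_demand_degree D <= n %/ 3)
  (hparts : forall (i j : 'I_3), i != j ->
      forall (d : dedge D) u v, u \in U i -> v \in V j -> ~~ joins d u v) :
  resolvable D.
Proof.
set k := n %/ 3 in hsize hDelta; pose x0 := Ordinal hn.
have [p pU] := disjoint_union_index ord0 hU.
have [q qV] := disjoint_union_index ord0 hV.
pose inL (x : 'I_n) : 'I_n + 'I_n := inl x.
pose inR (y : 'I_n) : 'I_n + 'I_n := inr y.
have inL_left x : inL x \in left_class n n by rewrite inE.
have inR_right y : inR y \in right_class n n by rewrite inE.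
have cU i : #|[set x | p (inL x) == i]| = #|U i|.
  apply: card_index_preim hU pU => [x y []|t] //.
  rewrite inE; case: t => y; first by rewrite codom_f.
  by apply/esym/negbTE/codomP=> -[].
have cV i : #|[set y | q (inR y) == i]| = #|U i|.
  rewrite hUV; apply: card_index_preim hV qV => [x y []|t] //.
  rewrite inE; case: t => y; last by rewrite codom_f.
  by apply/esym/negbTE/codomP=> -[].
pose r i := #|U i| - k.
have mE i : #|U i| = k + r i by rewrite subnKC.
(* The excesses [r i] add up to the remainder of [n] modulo 3. *)
have sum_r : \sum_i r i <= 2.
  have : \sum_i #|U i| = n.
    rewrite -[RHS]card_ord -sum1_card (partition_big (fun x => p (inL x)) predT) //=.
    by apply: eq_bigr => i _; rewrite -cU -sum1_card; apply: eq_bigl => x;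
      rewrite inE.
  rewrite (eq_bigr (fun i => k + r i)) => [|i _]; last exact: mE.
  rewrite big_split /= sum_nat_const card_ord /k; move: (\sum_i r i) => s; lia.
have r2 i j : i != j -> r i + r j <= 2.
  move=> nij; apply: leq_trans sum_r; rewrite (bigD1 i) //= leq_add2l.
  by rewrite (bigD1 j) ?leq_addr // eq_sym.
have /fin_all_exists[u /fin_all_exists[v uv]] :
    forall d : dedge D, exists x, exists y, joins d (inL x) (inR y).
  move=> d; have [[x|x] [[y|y] []]] := hbip d; rewrite !inE // => _ _ j.
  by exists x, y.
have pq d : p (inL (u d)) = q (inR (v d)).
  apply/eqP; apply: contraTT (uv d) => /hparts; apply.
    by rewrite pU.
  by rewrite qV.
have deg z : demand_degree D z <= k := leq_trans (leq_bigmax z) hDelta.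
have ends d z : (z == inL (u d)) || (z == inR (v d)) ->
    (z == (dends d).1) || (z == (dends d).2).
  by case/orP: (uv d) => /eqP-> //; rewrite orbC.
have du z : #|[set d | u d == z]| <= k.
  apply: leq_trans (deg (inL z)); apply/subset_leq_card/subsetP => d.
  by rewrite !inE => /eqP<-; rewrite ends ?eqxx.
have dv z : #|[set d | v d == z]| <= k.
  apply: leq_trans (deg (inR z)); apply/subset_leq_card/subsetP => d.
  by rewrite !inE => /eqP<-; rewrite ends ?eqxx ?orbT.
(* [ordS] is the cyclic successor: part [i] is routed through part [ordS i]. *)
have nx1 (i : 'I_3) : i != ordS i by case: i => [[|[|[|]]]].
have nx2 (i : 'I_3) : ordS (ordS i) != i by case: i => [[|[|[|]]]].
have dis (T : finType) (f : T -> 'I_3) i j : i != j ->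
    [disjoint [set x | f x == i] & [set x | f x == j]].
  move=> nij; rewrite -setI_eq0; apply/eqP/setP=> x; rewrite !inE.
  by apply/negP=> /andP[/eqP-> /idPn[]].
pose Di i := [set d | p (inL (u d)) == i].
have Dsub i (z : dedge D -> 'I_n) t :
    #|[set d | z d == t]| <= k -> #|[set d in Di i | z d == t]| <= k.
  by apply: leq_trans; apply/subset_leq_card/subsetP=> d; rewrite !inE => /andP[].
have DUV i : {in Di i, forall d, u d \in [set x | p (inL x) == i] /\
    v d \in [set y | q (inR y) == i]}.
  by move=> d; rewrite !inE -pq => ->.
have [H Hdeg routeH] := fin_all_exists2 (fun i =>
  route_part x0 x0 (fun z => Dsub i _ _ (du z)) (fun z => Dsub i _ _ (dv z)) (DUV i)
    (dis _ (fun x => p (inL x)) _ _ (nx1 i)) (dis _ (fun y => q (inR y)) _ _ (nx1 i))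
    (etrans (cU _) (mE _)) (etrans (cV _) (mE _)) (etrans (cU _) (mE _))
    (etrans (cV _) (mE _)) (r2 _ _ (nx1 i))).
have [R RP] := fin_all_exists (fun i => routeH i _ (Hdeg (ordS i))).
have inD d : d \in Di (p (inL (u d))) by rewrite inE.
apply: (@resolvable_of_routes n D u v (fun d => R (p (inL (u d))) d)) => //.
  by move=> d; have [simple _ _] := RP (p (inL (u d))); apply: simple.
move=> d f e ed ef.
have [pdf|/eqP npdf] := eqVneq (p (inL (u d))) (p (inL (u f))).
  have [_ _ disj] := RP (p (inL (u d))).
  by apply: (disj d f _ _ e); rewrite // ?inD ?pdf // -?pdf.
have [_ /(_ d (inD d) e ed) blockd _] := RP (p (inL (u d))).
have [_ /(_ f (inD f) e ef) blockf _] := RP (p (inL (u f))).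
move: blockd blockf npdf; move: (p (inL (u d))) (p (inL (u f))) => i j.
rewrite !inE; move: (p _) (q _) => a b blockd blockf [].
have inj := @ordS_inj 3.
(* Blocks with distinct indices never agree, by [nx2]. A common block is thus the diagonal block of
   a part [l] that succeeds the other; there part [l] stays inside [H l] and the other outside
   it. *)
move: blockf; case: blockd => [[/eqP-> /eqP->]|[/eqP-> /eqP->]|[/eqP-> /eqP->
  eH]|[/eqP-> /eqP-> eH]]
  [[/eqP e1 /eqP e2]|[/eqP e1 /eqP e2]|[/eqP e1 /eqP e2 fH]|[/eqP e1 /eqP e2 fH]];
  try exact: inj; try by [].
- by have := nx2 j; rewrite -e1 e2 eqxx.
- by have := nx2 j; rewrite -e2 e1 eqxx.
- by rewrite -e1 eH in fH.
- by rewrite e1 fH in eH.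
Qed.
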